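(* Consider the closed-loop system $x(k+1)=A_Gx(k)+B_G\pi(x(k))$, where $A_G\in\mathbb{R}^{n_x\times n_x}$, $B_G\in\mathbb{R}^{n_x\times n_u}$ are (unknown) constant matrices and $\pi$ is the neural network controller described in the context. Let $\mathcal{X}$ (initial states) and $\mathcal{S}$ (safe states) be non-empty polytopes $$\mathcal{X}=\{x\in\mathbb{R}^{n_x}: c_j^\top(x-x^{ini})+1\ge0,\ j=1,\dots,o\},\qquad \mathcal{S}=\{x\in\mathbb{R}^{n_x}: d_i^\top(x-x^{safe})+1\ge0,\ i=1,\dots,p\},$$ with $c_j,d_i\in\mathbb{R}^{n_x}$, $x^{ini}\in\mathcal{X}$, $x^{safe}\in\mathcal{S}$. Let $U_0\in\mathbb{R}^{n_u\times K}$, $X_0,X_1\in\mathbb{R}^{n_x\times K}$ be the data matrices described in the context (so $X_1=A_GX_0+B_GU_0$), and assume $\mathrm{rank}\begin{bmatrix}U_0\\ X_0\end{bmatrix}=n_x+n_u$ and $\mathrm{rank}(X_1)=n_x$. Let $\alpha_\phi,\beta_\phi,v_*\in\mathbb{R}^{n_\phi}$ be given with $\alpha_\phi\le\beta_\phi$ (elementwise), and $w_*:=\phi(v_* )$. Assume that $\phi$ satisfies elementwise the offset sector $[\alpha_\phi,\beta_\phi]$ centered on the point $(v_*,w_* )$. Let $T\ge1$ be an integer, and assume that for every $k=1,\dots,T$ and $i=1,\dots,p$ the program $\mathrm{P}(k,i)$ defined in the context (recursively in $k$) is feasible and has an optimal solution, with optimal value $\gamma_i^k$. If $$\gamma_i^k\le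 1,\qquad i=1,\dots,p,\quad k=1,\dots,T,$$ then the system is safe in the time interval $[1,T]$, i.e. for every $x(0)\in\mathcal{X}$ the trajectory satisfies $x(k)\in\mathcal{S}$ for all $k=1,\dots,T$.
   Context: Neural network controller. $\pi:\mathbb{R}^{n_x}\to\mathbb{R}^{n_u}$ is a feed-forward fully connected network with $l$ hidden layers: for input $x$, $w^0=x$, $v^i=W^iw^{i-1}+b^i$ and $w^i=\phi^i(v^i)$ for $i=1,\dots,l$, and $\pi(x)=W^{l+1}w^l+b^{l+1}$. Here $W^i\in\mathbb{R}^{n_i\times n_{i-1}}$, $b^i\in\mathbb{R}^{n_i}$, $n_0=n_x$, $n_{l+1}=n_u$, and $\phi^i(v^i)=[\varphi(v^i_1),\dots,\varphi(v^i_{n_i})]^\top$ for a scalar activation function $\varphi:\mathbb{R}\to\mathbb{R}$. It is assumed throughout that $\pi(0)=0$. Put $n_\phi=n_1+\dots+n_l$, and let $\phi:\mathbb{R}^{n_\phi}\to\mathbb{R}^{n_\phi}$ apply $\varphi$ to each entry. Data. For the open-loop system $x(k+1)=A_Gx(k)+B_Gu(k)$, noise-free data are collected: $U_0=[u(0)\ u(1)\ \cdots\ u(K-1)]$, $X_0=[x(0)\ x(1)\ \cdots\ x(K-1)]$, $X_1=[x(1)\ x(2)\ \cdots\ x(K)]$. Offset sector. For $\alpha\le\beta$ and $\nu_*\in\mathbb{R}$, $\varphi$ satisfies the offset sector $[\alpha,\beta]$ around $(\nu_*,\varphi(\nu_* ))$ if $\big((\varphi(\nu_* )-\varphi(\nu))-\alpha(\nu_*-\nu)\big)\big(\beta(\nu_*-\nu)-(\varphi(\nu_*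 )-\varphi(\nu))\big)\ge 0$ for all $\nu\in\mathbb{R}$. $\phi$ satisfies elementwise the offset sector $[\alpha_\phi,\beta_\phi]$ around $(v_*,w_* )$ if for each $i=1,\dots,n_\phi$, the $i$-th component function satisfies the offset sector $[\alpha_\phi^i,\beta_\phi^i]$ around $(v_*^i,\varphi(v_*^i))$. Polynomial notation. In the programs, $w=(w^0,w^1,\dots,w^l)$ is a vector of polynomial indeterminates with $w^i$ of dimension $n_i$; $w_\phi=(w^1,\dots,w^l)$, and $v_\phi=(W^1w^0+b^1,\dots,W^lw^{l-1}+b^l)$ is viewed as an affine function of $w$. $\Sigma[w]$ is the set of sum-of-squares polynomials in $w$ with real coefficients. $A_\phi=\mathrm{diag}(\alpha_\phi)$, $B_\phi=\mathrm{diag}(\beta_\phi)$. For a diagonal matrix $\Lambda$ put $$s_\Lambda(w)=\begin{bmatrix}v_\phi-v_*\\ w_\phi-w_*\end{bmatrix}^\top\begin{bmatrix}-2A_\phi B_\phi\Lambda&(A_\phi+B_\phi)\Lambda\\ (A_\phi+B_\phi)\Lambda&-2\Lambda\end{bmatrix}\begin{bmatrix}v_\phi-v_*\\ w_\phi-w_*\end{bmatrix}.$$ Program $\mathrm{P}(k,i)$ for $k\ge2$: given the optimal values $\gamma_1^{k-1},\dots,\gamma_p^{k-1}$ of $\mathrm{P}(k-1,1),\dots,\mathrm{P}(k-1,p)$, minimize $\gamma_i^k$ over $\gamma_i^k\in\mathbb{R}$, $g_1,\dots,g_p\in\Sigma[w]$, $\lambda\in\mathbb{R}^{n_\phi}$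 with $\lambda\ge0$, $\Lambda=\mathrm{diag}(\lambda)$, $G_1\in\mathbb{R}^{K\times n_x}$, $G_2\in\mathbb{R}^{K\times n_l}$, $G_3\in\mathbb{R}^{K\times1}$ (each $\mathrm{P}(k,i)$ has its own copies of these variables), subject to $$d_i^\top[X_1G_1w^0+X_1G_2w^l+X_1G_3-x^{safe}]+\gamma_i^k-\sum_{j=1}^p g_j(w)\,[d_j^\top(w^0-x^{safe})+\gamma_j^{k-1}]-s_\Lambda(w)\in\Sigma[w],$$ $$\begin{bmatrix}0\\ I_{n_x}\end{bmatrix}=\begin{bmatrix}U_0\\ X_0\end{bmatrix}G_1,\quad\begin{bmatrix}W^{l+1}\\ 0\end{bmatrix}=\begin{bmatrix}U_0\\ X_0\end{bmatrix}G_2,\quad\begin{bmatrix}b^{l+1}\\ 0\end{bmatrix}=\begin{bmatrix}U_0\\ X_0\end{bmatrix}G_3 .$$ Program $\mathrm{P}(1,i)$: the same, with the sum $\sum_{j=1}^p g_j(w)[d_j^\top(w^0-x^{safe})+\gamma_j^{k-1}]$ replaced by $\sum_{j=1}^o g_j(w)[c_j^\top(w^0-x^{ini})+1]$, with $g_1,\dots,g_o\in\Sigma[w]$ (i.e. the description of $\mathcal{X}$ is used for the initial set). *)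

(* Defs.v *)
From HB Require Import structures.
From mathcomp Require Import all_boot all_order all_algebra.
From mathcomp Require Import classical_sets reals.
From mathcomp Require Import mpoly.

Set Implicit Arguments.
Unset Strict Implicit.
Unset Printing Implicit Defensive.

Import Order.TTheory GRing.Theory Num.Theory.
Local Open Scope ring_scope.
Local Open Scope classical_set_scope.

Definition polytope (R : realType) (m n : nat) (a : 'I_m -> 'cV[R]_n)
    (x0 : 'cV[R]_n) : set 'cV[R]_n :=
  [set x | forall j, 0 <= ((a j)^T *m (x - x0)) 0 0 + 1].

Definition offset_sector (R : realType) (phi : R -> R) (alpha beta nus : R) :=
  forall nu : R,
    0 <= ((phi nus - phi nu) - alpha * (nus - nu)) *
         (beta * (nus - nu) - (phi nus - phi nu)).

Definition elementwise_offset_sector (R : realType) (m : nat) (phi : R -> R)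
    (alpha beta vs : 'cV[R]_m) :=
  forall i, offset_sector phi (alpha i 0) (beta i 0) (vs i 0).

Definition sos (R : realType) (N : nat) : set {mpoly R[N]} :=
  [set q | exists s : seq {mpoly R[N]}, q = \sum_(r <- s) r ^+ 2].

Definition polymx (R : realType) (N m n : nat) (A : 'M[R]_(m, n)) :
    'M[{mpoly R[N]}]_(m, n) := map_mx (@mpolyC N R) A.

Definition data_matrix (R : realType) (m K : nat) (x : nat -> 'cV[R]_m) :
    'M[R]_(m, K) := \matrix_(i < m, k < K) x k i 0.

Section Network.

(* The layer dimensions are n 0 = n_x, n 1, ..., n l, n l.+1 = n_u; W i and b i
   are the weight matrix and the bias from layer i to layer i.+1, i.e. they are
   usually written W^{i+1} and b^{i+1}.  Values of n, W, b beyond the output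
   layer l.+1 are never used. *)
Variables (R : realType) (l : nat) (n : nat -> nat).
Variables (W : forall i, 'M[R]_(n i.+1, n i)) (b : forall i, 'cV[R]_(n i.+1)).

Fixpoint layer (phi : R -> R) (x : 'cV[R]_(n 0%N)) (i : nat) : 'cV[R]_(n i) :=
  match i with
  | 0 => x
  | i'.+1 => map_mx phi (W i' *m layer phi x i' + b i')
  end.

Definition controller (phi : R -> R) (x : 'cV[R]_(n 0%N)) : 'cV[R]_(n l.+1) :=
  W l *m layer phi x l + b l.

Definition nphi := (\sum_(i < l) n i.+1)%N.
Definition nvar := (\sum_(i < l.+1) n i)%N.

(* wvar i is the block w^i of the indeterminates w = (w^0, ..., w^l). *)
Definition wvar (i : 'I_l.+1) : 'cV[{mpoly R[nvar]}]_(n i) :=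
  submxcol (p_ := fun i : 'I_l.+1 => n i) (\col_(j < nvar) 'X_j) i.

Definition w_phi : 'cV[{mpoly R[nvar]}]_nphi :=
  \mxcol_(i < l) (wvar (lift ord0 i) : 'cV_(n i.+1)).

Definition v_phi : 'cV[{mpoly R[nvar]}]_nphi :=
  \mxcol_(i < l)
    (polymx nvar (W i) *m wvar (widen_ord (leqnSn l) i) + polymx nvar (b i)).

Definition s_Lambda (alpha beta vs ws lambda : 'cV[R]_nphi) : {mpoly R[nvar]} :=
  let A := diag_mx alpha^T in
  let B := diag_mx beta^T in
  let L := diag_mx lambda^T in
  let z := col_mx (v_phi - polymx nvar vs) (w_phi - polymx nvar ws) in
  let M := block_mx (- 2 *: (A *m B *m L)) ((A + B) *m L)
                    ((A + B) *m L)         (- 2 *: L) in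
  (z^T *m polymx nvar M *m z) 0 0.

Definition halfspace_poly (a x0 : 'cV[R]_(n 0%N)) (r : R) : {mpoly R[nvar]} :=
  (polymx nvar a^T *m (wvar ord0 - polymx nvar x0)) 0 0 + r%:MP.

Variables (K : nat) (U0 : 'M[R]_(n l.+1, K)) (X0 X1 : 'M[R]_(n 0%N, K)).
Variables (alpha beta vs ws : 'cV[R]_nphi).

Definition successor_poly (G1 : 'M[R]_(K, n 0%N)) (G2 : 'M[R]_(K, n l))
    (G3 : 'cV[R]_K) : 'cV[{mpoly R[nvar]}]_(n 0%N) :=
  polymx nvar (X1 *m G1) *m wvar ord0 + polymx nvar (X1 *m G2) *m wvar ord_max
    + polymx nvar (X1 *m G3).

(* Feasibility of (gamma, g, lambda, G1, G2, G3) for the bound on the face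
   (d, xsafe), the states at the previous time step being described by the
   inequalities h j >= 0. *)
Definition feasible (d xsafe : 'cV[R]_(n 0%N)) (m : nat)
    (h : 'I_m -> {mpoly R[nvar]}) (gamma : R) (g : 'I_m -> {mpoly R[nvar]})
    (lambda : 'cV[R]_nphi)
    (G1 : 'M[R]_(K, n 0%N)) (G2 : 'M[R]_(K, n l)) (G3 : 'cV[R]_K) : Prop :=
  [/\ forall j, sos (g j),
      forall j, 0 <= lambda j 0,
      sos ((polymx nvar d^T *m (successor_poly G1 G2 G3 - polymx nvar xsafe)) 0 0
           + gamma%:MP - \sum_(j < m) g j * h j
           - s_Lambda alpha beta vs ws lambda)
    & [/\ col_mx 0 1%:M = col_mx U0 X0 *m G1,
          col_mx (W l) 0 = col_mx U0 X0 *m G2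
        & col_mx (b l) 0 = col_mx U0 X0 *m G3]].

Definition optimal_value (d xsafe : 'cV[R]_(n 0%N)) (m : nat)
    (h : 'I_m -> {mpoly R[nvar]}) (gamma : R) : Prop :=
  (exists g lambda G1 G2 G3, feasible d xsafe h gamma g lambda G1 G2 G3) /\
  (forall gamma' g lambda G1 G2 G3,
     feasible d xsafe h gamma' g lambda G1 G2 G3 -> gamma <= gamma').

(* gamma k i is the optimal value of the program P(k, i).  Only k >= 1 is
   meaningful: P(1, i) starts from the initial set, P(k, i) for k >= 2 from the
   bounds gamma k.-1 obtained at the previous step. *)
Definition program_optimal_value (o : nat) (c : 'I_o -> 'cV[R]_(n 0%N))
    (xini : 'cV[R]_(n 0%N)) (p : nat) (d : 'I_p -> 'cV[R]_(n 0%N))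
    (xsafe : 'cV[R]_(n 0%N)) (gamma : nat -> 'I_p -> R) (k : nat) (i : 'I_p) :
    Prop :=
  if k is k'.+2
  then optimal_value (d i) xsafe
         (fun j => halfspace_poly (d j) xsafe (gamma k'.+1 j)) (gamma k i)
  else optimal_value (d i) xsafe
         (fun j => halfspace_poly (c j) xini 1) (gamma k i).

End Network.

(* Main.v *)
Require Import Defs.
From HB Require Import structures.
From mathcomp Require Import all_boot all_order all_algebra.
From mathcomp Require Import classical_sets reals.
From mathcomp Require Import mpoly ring lra.

Set Implicit Arguments.
Unset Strict Implicit.
Unset Printing Implicit Defensive.

Import Order.TTheory GRing.Theory Num.Theory.
Local Open Scope ring_scope.
Local Open Scope classical_set_scope.

(** Each program certifies one step of the closed loop, and the theorem follows
by induction on time.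

The data constraints on [G1], [G2], [G3] force
[X1 *m G1 = A_G], [X1 *m G2 = B_G *m W l] and [X1 *m G3 = B_G *m b l]
([data_driven_product]): the products known from the data replace the unknown
plant.  Substitute for the indeterminates [w] the activations of the network at
an actual state [x].  Under this substitution the successor polynomial becomes
the next state, a sum of squares becomes a nonnegative number, and [s_Lambda]
becomes a sum over the neurons of [2 * lambda i] times the product of the two
factors of the offset sector at the actual preactivation, hence is nonnegative
([at_state_s_Lambda_ge0]).  The sum-of-squares constraint of the program
therefore yields [d^T (x' - xsafe) + gamma >= 0] for the next state [x'] as soon
as [x] satisfies the inequalities describing the previous step
([feasible_successor]).

By induction on [k], starting from the description of the initial set, the
state at time [k] satisfies [(d i)^T (x k - xsafe) + gamma k i >= 0] for every
face [i]; since [gamma k i <= 1], it is safe. *)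

Lemma data_matrix_step (R : realType) (nx nu K : nat) (A : 'M[R]_nx)
    (B : 'M[R]_(nx, nu)) (u : nat -> 'cV[R]_nu) (x : nat -> 'cV[R]_nx) :
    (forall k, (k < K)%N -> x k.+1 = A *m x k + B *m u k) ->
  data_matrix K (fun k => x k.+1) = A *m data_matrix K x + B *m data_matrix K u.
Proof.
move=> step; apply/matrixP=> i k; rewrite !mxE step // !mxE.
by congr (_ + _); apply: eq_bigr => j _; rewrite !mxE.
Qed.

(** The left-hand side is [X1 *m G], where [X1] collects the successors of the
recorded states: it is known from the data, although [A] and [B] are not. *)
Lemma data_driven_product (R : realType) (nx nu K q : nat) (A : 'M[R]_nx)
    (B : 'M[R]_(nx, nu)) (U0 : 'M[R]_(nu, K)) (X0 : 'M[R]_(nx, K))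
    (V : 'M[R]_(nu, q)) (Y : 'M[R]_(nx, q)) (G : 'M[R]_(K, q)) :
  col_mx V Y = col_mx U0 X0 *m G ->
  (A *m X0 + B *m U0) *m G = A *m Y + B *m V.
Proof.
rewrite mul_col_mx => /eq_col_mx[-> ->].
by rewrite mulmxDl !mulmxA.
Qed.

(** The quadratic form of [s_Lambda] is diagonal: it splits into one product of
sector factors per coordinate. *)
Lemma sector_quadratic_formE (R : comNzRingType) (m : nat)
    (alpha beta lambda y z : 'cV[R]_m) :
  ((col_mx y z)^T *m
   block_mx (- 2 *: (diag_mx alpha^T *m diag_mx beta^T *m diag_mx lambda^T))
            ((diag_mx alpha^T + diag_mx beta^T) *m diag_mx lambda^T)
            ((diag_mx alpha^T + diag_mx beta^T) *m diag_mx lambda^T)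
            (- 2 *: diag_mx lambda^T) *m col_mx y z) 0 0 =
  \sum_i 2 * lambda i 0 *
    ((z i 0 - alpha i 0 * y i 0) * (beta i 0 * y i 0 - z i 0)).
Proof.
rewrite tr_col_mx mul_row_block mul_row_col !mulmxDl !mulmxDr !mulmxDl.
rewrite -!scalemxAr -!scalemxAl !mulmxA !mul_mx_diag !mxE.
rewrite !mulr_sumr -!big_split /=; apply: eq_bigr => i _.
by rewrite !mxE; ring.
Qed.

Lemma offset_sector_form_ge0 (R : realType) (m : nat) (phi : R -> R)
    (alpha beta vs lambda v : 'cV[R]_m) :
    elementwise_offset_sector phi alpha beta vs ->
    (forall i, 0 <= lambda i 0) ->
  0 <= \sum_i 2 * lambda i 0 *
    (((map_mx phi v - map_mx phi vs) i 0 - alpha i 0 * (v - vs) i 0) *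
     (beta i 0 * (v - vs) i 0 - (map_mx phi v - map_mx phi vs) i 0)).
Proof.
move=> sector lambda_ge0; apply: sumr_ge0 => i _.
apply: mulr_ge0; first by rewrite mulr_ge0.
rewrite !mxE.
(* The sector hypothesis uses the opposite increments; both factors change
   sign. *)
suff -> : forall f fs x xs a c : R,
    (f - fs - a * (x - xs)) * (c * (x - xs) - (f - fs)) =
    ((fs - f) - a * (xs - x)) * (c * (xs - x) - (fs - f)) by apply: sector.
by move=> *; ring.
Qed.

Section Evaluation.

Variables (R : realType) (l : nat) (n : nat -> nat).
Variables (W : forall i, 'M[R]_(n i.+1, n i)) (b : forall i, 'cV[R]_(n i.+1)).
Variables (phi : R -> R) (x : 'cV[R]_(n 0%N)).

(** The values of all indeterminates at the state [x]: the stacked outputs of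
layers [0] to [l], where layer [0] is [x] itself. *)
Definition network_state (j : 'I_(nvar l n)) : R :=
  (\mxcol_(i < l.+1) layer W b phi x i) j 0.

(** Evaluation of a polynomial at the network state. *)
Definition at_state : {mpoly R[nvar l n]} -> R := meval network_state.

HB.instance Definition _ := GRing.RMorphism.on at_state.

Lemma at_stateC a : at_state a%:MP = a.
Proof. exact: mevalC. Qed.

Lemma at_state_polymx (m q : nat) (A : 'M[R]_(m, q)) :
  map_mx at_state (polymx (nvar l n) A) = A.
Proof. by apply/matrixP=> i j; rewrite !mxE at_stateC. Qed.

Lemma at_state_wvar (i : 'I_l.+1) :
  map_mx at_state (wvar R n i) = layer W b phi x i.
Proof.
rewrite -[RHS](mxcolK (fun i : 'I_l.+1 => layer W b phi x i)).
by apply/matrixP=> j k; rewrite !mxE [at_state _]mevalXU (ord1 k) /network_state !mxE.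
Qed.

(** The stacked inputs of the activation functions of all hidden layers. *)
Definition preactivation : 'cV[R]_(nphi l n) :=
  \mxcol_(i < l) (W i *m layer W b phi x i + b i).

Lemma at_state_v_phi : map_mx at_state (v_phi l W b) = preactivation.
Proof.
apply/matrixP=> j k; rewrite mxE [v_phi _ _ _ _ _]mxE [RHS]mxE.
set i := tagnat.sig1 j; set r := tagnat.sig2 j.
rewrite -[in RHS](at_state_polymx (W i)) -[in RHS](at_state_polymx (b i)).
rewrite -[layer _ _ _ _ i]/(layer W b phi x (widen_ord (leqnSn l) i)).
by rewrite -at_state_wvar -map_mxM -map_mxD [RHS]mxE.
Qed.

Lemma at_state_w_phi :
  map_mx at_state (w_phi R l n) = map_mx phi preactivation.
Proof.
apply/matrixP=> j k; rewrite mxE [w_phi _ _ _ _ _]mxE.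
set i := tagnat.sig1 j; set r := tagnat.sig2 j.
have /matrixP/(_ r k) := at_state_wvar (lift ord0 i).
by rewrite mxE => ->; rewrite !mxE.
Qed.

Lemma at_state_sos q : sos q -> 0 <= at_state q.
Proof.
case=> s ->; rewrite rmorph_sum; apply: sumr_ge0 => r _.
by rewrite rmorphXn sqr_ge0.
Qed.

Lemma at_state_halfspace (a x0 : 'cV[R]_(n 0%N)) (r : R) :
  at_state (halfspace_poly l a x0 r) = (a^T *m (x - x0)) 0 0 + r.
Proof.
rewrite rmorphD /= at_stateC; congr (_ + _).
have -> : x - x0 = map_mx at_state (wvar R n ord0 - polymx _ x0).
  by rewrite map_mxB at_state_polymx at_state_wvar.
by rewrite -[a^T in RHS]at_state_polymx -map_mxM [RHS]mxE.
Qed.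

Lemma at_state_s_Lambda_ge0 (alpha beta vs lambda : 'cV[R]_(nphi l n)) :
    elementwise_offset_sector phi alpha beta vs ->
    (forall i, 0 <= lambda i 0) ->
  0 <= at_state (s_Lambda W b alpha beta vs (map_mx phi vs) lambda).
Proof.
move=> sector lambda_ge0.
have := offset_sector_form_ge0 preactivation sector lambda_ge0.
rewrite -sector_quadratic_formE /s_Lambda.
set M := block_mx _ _ _ _; set z := col_mx _ _; set zp := col_mx _ _.
have zE : z = map_mx at_state zp.
  by rewrite map_col_mx !map_mxB !at_state_polymx at_state_v_phi at_state_w_phi.
suff -> : (z^T *m M *m z) 0 0 = at_state ((zp^T *m polymx _ M *m zp) 0 0) by [].
rewrite zE -[M in LHS]at_state_polymx map_trmx.
by rewrite -map_mxM -map_mxM [LHS]mxE.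
Qed.

(** One-step certificate: a feasible point of a program bounds the successor of
every state [x] that satisfies the inequalities [h j >= 0]. *)
Lemma feasible_successor (K : nat) (U0 : 'M[R]_(n l.+1, K))
    (X0 : 'M[R]_(n 0%N, K)) (A : 'M[R]_(n 0%N)) (B : 'M[R]_(n 0%N, n l.+1))
    (alpha beta vs : 'cV[R]_(nphi l n)) (d xsafe : 'cV[R]_(n 0%N)) (m : nat)
    (h : 'I_m -> {mpoly R[nvar l n]}) (gamma : R) g lambda G1 G2 G3 :
    elementwise_offset_sector phi alpha beta vs ->
    feasible W b U0 X0 (A *m X0 + B *m U0) alpha beta vs (map_mx phi vs)
      d xsafe h gamma g lambda G1 G2 G3 ->
    (forall j, 0 <= at_state (h j)) ->
  0 <= (d^T *m (A *m x + B *m controller l W b phi x - xsafe)) 0 0 + gamma.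
Proof.
move=> sector [sos_g lambda_ge0 /at_state_sos cert [eqG1 eqG2 eqG3]] h_ge0.
pose succ := successor_poly (A *m X0 + B *m U0) G1 G2 G3.
have succE : A *m x + B *m controller l W b phi x = map_mx at_state succ.
  rewrite !map_mxD !map_mxM !at_state_polymx.
  rewrite (at_state_wvar ord0) (at_state_wvar ord_max).
  rewrite !(data_driven_product _ _ eqG1, data_driven_product _ _ eqG2,
            data_driven_product _ _ eqG3).
  by rewrite mulmx1 !mulmx0 addr0 !add0r mulmxDr mulmxA addrA.
have -> : (d^T *m (A *m x + B *m controller l W b phi x - xsafe)) 0 0
    = at_state ((polymx _ d^T *m (succ - polymx _ xsafe)) 0 0).
  rewrite succE -[xsafe in LHS]at_state_polymx -[d^T in LHS]at_state_polymx.
  by rewrite -map_mxB -map_mxM [LHS]mxE.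
have s_ge0 := at_state_s_Lambda_ge0 sector lambda_ge0.
have gh_ge0 : 0 <= at_state (\sum_(j < m) g j * h j).
  rewrite rmorph_sum sumr_ge0 // => j _.
  by rewrite rmorphM mulr_ge0 // at_state_sos.
move: cert; rewrite !rmorphB rmorphD /= at_stateC -/succ.
lra.
Qed.

End Evaluation.

Theorem theorem5 (R : realType)
    (* neural network: n 0 = n_x, n l.+1 = n_u *)
    (l : nat) (n : nat -> nat)
    (W : forall i, 'M[R]_(n i.+1, n i)) (b : forall i, 'cV[R]_(n i.+1))
    (phi : R -> R)
    (hpi0 : controller l W b phi 0 = 0)
    (* plant *)
    (A_G : 'M[R]_(n 0%N)) (B_G : 'M[R]_(n 0%N, n l.+1))
    (* initial and safe sets *)
    (o p : nat) (c : 'I_o -> 'cV[R]_(n 0%N)) (d : 'I_p -> 'cV[R]_(n 0%N))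
    (xini xsafe : 'cV[R]_(n 0%N))
    (hXne : polytope c xini !=set0) (hSne : polytope d xsafe !=set0)
    (hxini : polytope c xini xini) (hxsafe : polytope d xsafe xsafe)
    (* data *)
    (K : nat) (udata : nat -> 'cV[R]_(n l.+1)) (xdata : nat -> 'cV[R]_(n 0%N))
    (hdata : forall k, (k < K)%N ->
       xdata k.+1 = A_G *m xdata k + B_G *m udata k)
    (U0 : 'M[R]_(n l.+1, K)) (hU0 : U0 = data_matrix K udata)
    (X0 : 'M[R]_(n 0%N, K)) (hX0 : X0 = data_matrix K xdata)
    (X1 : 'M[R]_(n 0%N, K)) (hX1 : X1 = data_matrix K (fun k => xdata k.+1))
    (hrank0 : \rank (col_mx U0 X0) = (n 0 + n l.+1)%N)
    (hrank1 : \rank X1 = n 0%N)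
    (* offset sector *)
    (alpha beta vs ws : 'cV[R]_(nphi l n))
    (hab : forall i, alpha i 0 <= beta i 0)
    (hws : ws = map_mx phi vs)
    (hsector : elementwise_offset_sector phi alpha beta vs)
    (* programs *)
    (T : nat) (hT : (1 <= T)%N)
    (gamma : nat -> 'I_p -> R)
    (hopt : forall k i, (1 <= k <= T)%N ->
       program_optimal_value W b U0 X0 X1 alpha beta vs ws c xini d xsafe
         gamma k i)
    (hgamma : forall k i, (1 <= k <= T)%N -> gamma k i <= 1) :
  forall x : nat -> 'cV[R]_(n 0%N),
    polytope c xini (x 0%N) ->
    (forall k, x k.+1 = A_G *m x k + B_G *m controller l W b phi (x k)) ->
    forall k, (1 <= k <= T)%N -> polytope d xsafe (x k).
Proof.
move=> x x0X step.
have X1E : X1 = A_G *m X0 + B_G *m U0.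
  by rewrite hX1 hX0 hU0; exact: data_matrix_step.
rewrite {}X1E {}hws in hopt.
have bound k i : (1 <= k <= T)%N ->
    0 <= ((d i)^T *m (x k - xsafe)) 0 0 + gamma k i.
  elim: k i => [|k IHk] i kT; first by [].
  have := hopt _ i kT; case: k IHk kT => [|k] IHk kT.
    move=> [[g [lambda [G1 [G2 [G3 feas]]]]] _].
    rewrite step; apply: feasible_successor hsector feas _ => j.
    rewrite at_state_halfspace; exact: x0X.
  move=> [[g [lambda [G1 [G2 [G3 feas]]]]] _].
  rewrite step; apply: feasible_successor hsector feas _ => j.
  rewrite at_state_halfspace; apply: IHk; exact: ltnW.
move=> k kT i; apply: le_trans (bound k i kT) _.
by rewrite lerD2l hgamma.
Qed.
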